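(* Let $n$ be a non-negative integer and $s$ any integer. Then \[ \sum_{k = 0}^n \binom nk F_{k + s}^3 = \frac{1}{5}\left(2^n F_{2n + 3s} + 3F_{n - s}\right),\qquad \sum_{k = 0}^n \binom nk L_{k + s}^3 = 2^n L_{2n + 3s} + 3L_{n - s}, \] \[ \sum_{k = 0}^n (-1)^k\binom nk F_{k + s}^3 = \frac{1}{5}\left((-1)^n 2^n F_{n + 3s} - (-1)^s 3F_{2n + s}\right),\qquad \sum_{k = 0}^n (-1)^k\binom nk L_{k + s}^3 = (-1)^n 2^n L_{n + 3s} + (-1)^s 3L_{2n + s}, \] \[ \sum_{k = 0}^n \binom nk 2^k F_{k + s}^3 = \begin{cases} 5^{n/2 - 1}\left(F_{3n + 3s} - (-1)^s 3F_s\right), & n \text{ even},\\ 5^{(n - 3)/2}\left(L_{3n + 3s} + (-1)^s 3L_s\right), & n \text{ odd},\end{cases} \] \[ \sum_{k = 0}^n \binom nk 2^k L_{k + s}^3 = \begin{cases} 5^{n/2}\left(L_{3n + 3s} + (-1)^s 3L_s\right), & n \text{ even},\\ 5^{(n + 1)/2}\left(F_{3n + 3s} - (-1)^s 3F_s\right), & n \text{ odd}.\end{cases} \]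
   Context: The Fibonacci numbers $F_n$ and Lucas numbers $L_n$ are defined for all integers $n$ by $F_0=0$, $F_1=1$, $L_0=2$, $L_1=1$, $F_n=F_{n-1}+F_{n-2}$, $L_n=L_{n-1}+L_{n-2}$, extended to negative indices by $F_{-n}=(-1)^{n-1}F_n$, $L_{-n}=(-1)^nL_n$. *)

(* Defs.v *)
From mathcomp Require Import all_boot all_order all_algebra.
From mathcomp Require Import ring zify.

Set Implicit Arguments.
Unset Strict Implicit.
Unset Printing Implicit Defensive.

Import Order.TTheory GRing.Theory Num.Theory.
Local Open Scope ring_scope.

Fixpoint fib_nat (n : nat) : int :=
  match n with
  | 0%N => 0
  | 1%N => 1
  | (m.+1 as p).+1 => fib_nat p + fib_nat m
  end.

Fixpoint lucas_nat (n : nat) : int :=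
  match n with
  | 0%N => 2
  | 1%N => 1
  | (m.+1 as p).+1 => lucas_nat p + lucas_nat m
  end.

(* [Negz m] denotes -(m + 1), so that the negative branches below are
   F_{-j} = (-1)^(j-1) F_j and L_{-j} = (-1)^j L_j at j = m + 1. *)
Definition fib (n : int) : int :=
  match n with
  | Posz m => fib_nat m
  | Negz m => (-1) ^+ m * fib_nat m.+1
  end.

Definition lucas (n : int) : int :=
  match n with
  | Posz m => lucas_nat m
  | Negz m => (-1) ^+ m.+1 * lucas_nat m.+1
  end.

Lemma fib_natSS (n : nat) : fib_nat n.+2 = fib_nat n.+1 + fib_nat n.
Proof. by []. Qed.

Lemma lucas_natSS (n : nat) : lucas_nat n.+2 = lucas_nat n.+1 + lucas_nat n.
Proof. by []. Qed.

Lemma fib_rec (n : int) : fib n = fib (n - 1) + fib (n - 2).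
Proof.
case: n => [[|[|n]]|n].
- by [].
- by [].
- have -> : Posz n.+2 - 1 = Posz n.+1 by lia.
  by have -> : Posz n.+2 - 2 = Posz n by lia.
have -> : Negz n - 1 = Negz n.+1 by lia.
have -> : Negz n - 2 = Negz n.+2 by lia.
by rewrite /fib [fib_nat n.+3]fib_natSS [fib_nat n.+2]fib_natSS !exprS; ring.
Qed.

Lemma lucas_rec (n : int) : lucas n = lucas (n - 1) + lucas (n - 2).
Proof.
case: n => [[|[|n]]|n].
- by [].
- by [].
- have -> : Posz n.+2 - 1 = Posz n.+1 by lia.
  by have -> : Posz n.+2 - 2 = Posz n by lia.
have -> : Negz n - 1 = Negz n.+1 by lia.
have -> : Negz n - 2 = Negz n.+2 by lia.
rewrite /lucas [lucas_nat n.+3]lucas_natSS [lucas_nat n.+2]lucas_natSS !exprS.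
by ring.
Qed.

(* The identities involve 1/5 and possibly negative powers of 5, hence are
   stated in [rat]. *)
Notation "''F_{' n }" := ((fib n)%:~R : rat)
  (at level 8, n at level 99, format "''F_{' n }") : ring_scope.
Notation "''L_{' n }" := ((lucas n)%:~R : rat)
  (at level 8, n at level 99, format "''L_{' n }") : ring_scope.

(* Main.v *)
(** The cubes linearise: [5 F_m^3 = F_{3m} - 3 (-1)^m F_m] and
    [L_m^3 = L_{3m} + 3 (-1)^m L_m].  By Pascal's rule a binomial sum
    [T n s] of [c ^ k f (k + s)] is the only solution of
    [T (n + 1) s = T n s + c T n (s + 1)] and [T 0 s = f s], so each closed form
    only has to satisfy this recurrence, where it is a linear identity
    between neighbouring Fibonacci numbers. *)
Require Import Defs.
From mathcomp Require Import all_boot all_order all_algebra.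
From mathcomp Require Import ring zify.

Import Order.TTheory GRing.Theory Num.Theory.
Local Open Scope ring_scope.

(** A second-order recurrence is determined on all integers by two adjacent values, run forwards and
    backwards; this is the matching induction, which carries the pair [P a], [P (a + 1)]. *)
Lemma int_ind2 (P : int -> Prop) :
    P 0 -> P 1 -> (forall a : int, P a -> P (a + 1) -> P (a + 1 + 1)) ->
    (forall a : int, P (a + 1) -> P (a + 1 + 1) -> P a) ->
  forall a : int, P a.
Proof.
move=> P0 P1 up down a; suff [] : P a /\ P (a + 1) by [].
elim/int_rect: a => [|n [IH1 IH2]|n [IH1 IH2]].
- by rewrite add0r.
- have -> : Posz n.+1 = n%:Z + 1 by lia.
  by split=> //; apply: up.
have e : - n.+1%:Z + 1 = - n%:Z by lia.
by split; [apply: down; rewrite e | rewrite e].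
Qed.

Lemma fibSS (a : int) : fib (a + 1 + 1) = fib (a + 1) + fib a.
Proof. by rewrite fib_rec; congr (fib _ + fib _); lia. Qed.

Lemma lucasSS (a : int) : lucas (a + 1 + 1) = lucas (a + 1) + lucas a.
Proof. by rewrite lucas_rec; congr (lucas _ + lucas _); lia. Qed.

(** Eliminates Lucas numbers: later identities become polynomial in two adjacent Fibonacci numbers,
    within reach of [ring]. *)
Lemma lucas_fib (a : int) : lucas a = 2 * fib (a + 1) - fib a.
Proof.
elim/int_ind2: a => // a IH1 IH2.
  by rewrite lucasSS IH1 IH2 !fibSS; ring.
have := lucasSS a; rewrite IH1 IH2 !fibSS.
by move: (fib (a + 1)) (fib a) (lucas a); lia.
Qed.

(** For fixed [a] both sides obey the Fibonacci recurrence in [b]. The difference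
    [fib (a + 1) - fib a] is F_{a-1}, written so that only the indices [a] and [a + 1] occur. *)
Lemma fibD (a b : int) :
  fib (a + b) = fib a * fib (b + 1) + (fib (a + 1) - fib a) * fib b.
Proof.
elim/int_ind2: b => [||b IH1 IH2|b IH1 IH2].
- by rewrite addr0 add0r mulr1 mulr0 addr0.
- by rewrite (_ : fib (1 + 1) = 1) // (_ : fib 1 = 1) //; ring.
- rewrite !(addrA a) in IH2 *.
  by rewrite (fibSS (a + b)) IH1 IH2 !fibSS; ring.
rewrite !(addrA a) in IH1 IH2; have := fibSS (a + b); rewrite IH1 IH2 !fibSS.
by move=> /esym/(canRL (addKr _)) ->; ring.
Qed.

Lemma ratFSS (a : int) : 'F_{a + 1 + 1} = 'F_{a + 1} + 'F_{a}.
Proof. by rewrite fibSS rmorphD. Qed.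

Lemma ratL (a : int) : 'L_{a} = 2 * 'F_{a + 1} - 'F_{a}.
Proof. by rewrite lucas_fib rmorphB rmorphM. Qed.

Lemma ratFD (a b : int) :
  'F_{a + b} = 'F_{a} * 'F_{b + 1} + ('F_{a + 1} - 'F_{a}) * 'F_{b}.
Proof. by rewrite fibD rmorphD !rmorphM rmorphB. Qed.

Lemma signzS (a : int) : (-1) ^ (a + 1) = - (-1) ^ a :> rat.
Proof. by rewrite exprzDr ?unitrN1 // expr1z mulrN1. Qed.

Lemma signz_sqr (a : int) : (-1) ^ a * (-1) ^ a = 1 :> rat.
Proof. by rewrite -expfzMl mulrNN mulr1 exp1rz. Qed.

(** The form y^2 - yx - x^2 changes sign under (x, y) -> (y, x + y). The identity serves to replace
    the sign by a quadratic polynomial in ['F_{a}] and ['F_{a + 1}]. *)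
Lemma cassini (a : int) :
  (-1) ^ a = 'F_{a + 1} ^+ 2 - 'F_{a + 1} * 'F_{a} - 'F_{a} ^+ 2.
Proof.
elim/int_ind2: a => // a IH1 IH2.
  by rewrite signzS IH2 !ratFSS; ring.
by apply: oppr_inj; rewrite -signzS IH1 ratFSS; ring.
Qed.

(** The addition formula at a + (-a) and (a + 1) + (-a) gives two linear equations in F_{-a} and
    F_{-a+1}, whose determinant is, up to sign, the Cassini form. *)
Lemma ratFN (a : int) : 'F_{- a} = - ((-1) ^ a * 'F_{a}).
Proof.
have e0 : 0 = 'F_{a} * 'F_{- a + 1} + ('F_{a + 1} - 'F_{a}) * 'F_{- a}.
  by rewrite -ratFD subrr.
have e1 : 1 = 'F_{a + 1} * 'F_{- a + 1} + 'F_{a} * 'F_{- a}.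
  have := ratFD (a + 1) (- a); rewrite addrAC subrr ratFSS.
  by rewrite (addrC 'F_{a + 1} 'F_{a}) addrK => <-.
have eF : (-1) ^ a * 'F_{- a} = - 'F_{a}.
  rewrite cassini; move: 'F_{a} 'F_{a + 1} 'F_{- a} 'F_{- a + 1} e0 e1.
  (* The combination y * [e0] - x * [e1] cancels v = F_{-a+1}. *)
  move=> x y u v e0 e1; transitivity (y * 0 - x * 1); last by ring.
  by rewrite e0 e1; ring.
by rewrite -mulrN -eF mulrA signz_sqr mul1r.
Qed.

Lemma ratLN (a : int) : 'L_{- a} = (-1) ^ a * 'L_{a}.
Proof.
rewrite !ratL; have -> : - a + 1 = - (a - 1) by lia.
rewrite !ratFN -[a](subrK 1); move: (a - 1) => b.
by rewrite addrK signzS ratFSS; ring.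
Qed.

(** Two uses of the addition formula make F_{3s} a cubic form in F_s and F_{s+1}; with the sign
    replaced by the Cassini form, both sides are such cubics. *)
Lemma ratF_cube (s : int) :
  'F_{s} ^+ 3 = 5^-1 * ('F_{3 * s} - (-1) ^ s * 3 * 'F_{s}).
Proof.
have -> : 3 * s = s + (s + s) by lia.
rewrite (ratFD s (s + s)) -(addrA s s 1) (ratFD s s) (ratFD s (s + 1)) ratFSS.
by rewrite cassini; field.
Qed.

Lemma ratL_cube (s : int) :
  'L_{s} ^+ 3 = 'L_{3 * s} + (-1) ^ s * 3 * 'L_{s}.
Proof.
have -> : 3 * s = s + (s + s) by lia.
rewrite !ratL (addrAC s (s + s) 1) (ratFD (s + 1) (s + s)) (ratFD s (s + s)).
rewrite -(addrA s s 1) (ratFD s s) (ratFD s (s + 1)) ratFSS.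
by rewrite cassini; ring.
Qed.

Lemma sum_binomial_rec (R : comPzRingType) (c : R) (f : int -> R)
    (T : nat -> int -> R) :
    (forall s, T 0 s = f s) ->
    (forall n s, T n.+1 s = T n s + c * T n (s + 1)) ->
  forall n s, \sum_(k < n.+1) 'C(n, k)%:R * c ^+ k * f (k%:Z + s) = T n s.
Proof.
move=> T0 TS; elim=> [|n IH] s.
  by rewrite big_ord1 T0 bin0 expr0 !mul1r add0r.
rewrite TS -!IH big_ord_recl /= [in RHS]big_ord_recl /= !bin0 -addrA; congr (_ + _).
under eq_bigr => k _ do
  rewrite /bump add1n binS natrD !mulrDl.
rewrite big_split /=; congr (_ + _).
  (* The surplus top term has coefficient ['C(n, n.+1)], which is 0. *)
  by rewrite big_ord_recr /= bin_small // !mul0r addr0.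
rewrite mulr_sumr; apply: eq_bigr => k _.
have -> : k.+1%:Z + s = k%:Z + (s + 1) by lia.
by rewrite exprS; ring.
Qed.

Lemma sum_fib_cube (n : nat) (s : int) :
  \sum_(k < n.+1) 'C(n, k)%:R * 1 ^+ k * 'F_{k%:Z + s} ^+ 3
    = 5^-1 * (2 ^+ n * 'F_{2 * n%:Z + 3 * s} + 3 * 'F_{n%:Z - s}).
Proof.
move: n s; apply: (@sum_binomial_rec _ _ (fun m => 'F_{m} ^+ 3)) => [s|n s].
  by rewrite ratF_cube mulr0 !add0r ratFN; ring.
(* With the lowest indices named, the recurrence reduces to 2F_{a+2} = F_a + F_{a+3} and F_{b+2} =
   F_{b+1} + F_b. *)
set a := 2 * n%:Z + 3 * s; set b := n%:Z - (s + 1).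
have -> : 2 * n.+1%:Z + 3 * s = a + 1 + 1 by rewrite /a; lia.
have -> : 2 * n%:Z + 3 * (s + 1) = a + 1 + 1 + 1 by rewrite /a; lia.
have -> : n.+1%:Z - s = b + 1 + 1 by rewrite /b; lia.
have -> : n%:Z - s = b + 1 by rewrite /b; lia.
by rewrite !ratFSS exprS; ring.
Qed.

Lemma sum_lucas_cube (n : nat) (s : int) :
  \sum_(k < n.+1) 'C(n, k)%:R * 1 ^+ k * 'L_{k%:Z + s} ^+ 3
    = 2 ^+ n * 'L_{2 * n%:Z + 3 * s} + 3 * 'L_{n%:Z - s}.
Proof.
move: n s; apply: (@sum_binomial_rec _ _ (fun m => 'L_{m} ^+ 3)) => [s|n s].
  by rewrite ratL_cube mulr0 !add0r ratLN; ring.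
set a := 2 * n%:Z + 3 * s; set b := n%:Z - (s + 1).
have -> : 2 * n.+1%:Z + 3 * s = a + 1 + 1 by rewrite /a; lia.
have -> : 2 * n%:Z + 3 * (s + 1) = a + 1 + 1 + 1 by rewrite /a; lia.
have -> : n.+1%:Z - s = b + 1 + 1 by rewrite /b; lia.
have -> : n%:Z - s = b + 1 by rewrite /b; lia.
by rewrite !ratL !ratFSS exprS; ring.
Qed.

Lemma alt_sum_fib_cube (n : nat) (s : int) :
  \sum_(k < n.+1) 'C(n, k)%:R * (-1) ^+ k * 'F_{k%:Z + s} ^+ 3
    = 5^-1 * ((-1) ^+ n * 2 ^+ n * 'F_{n%:Z + 3 * s}
              - (-1) ^ s * 3 * 'F_{2 * n%:Z + s}).
Proof.
move: n s; apply: (@sum_binomial_rec _ _ (fun m => 'F_{m} ^+ 3)) => [s|n s].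
  by rewrite ratF_cube mulr0 !add0r; ring.
(* Here the first part needs -2F_{a+1} = F_a - F_{a+3}; in the second, the sign change of (-1)^s at
   s + 1 cancels c = -1. *)
set a := n%:Z + 3 * s; set b := 2 * n%:Z + s.
have -> : n.+1%:Z + 3 * s = a + 1 by rewrite /a; lia.
have -> : n%:Z + 3 * (s + 1) = a + 1 + 1 + 1 by rewrite /a; lia.
have -> : 2 * n.+1%:Z + s = b + 1 + 1 by rewrite /b; lia.
have -> : 2 * n%:Z + (s + 1) = b + 1 by rewrite /b; lia.
by rewrite signzS !ratFSS !exprS; ring.
Qed.

Lemma alt_sum_lucas_cube (n : nat) (s : int) :
  \sum_(k < n.+1) 'C(n, k)%:R * (-1) ^+ k * 'L_{k%:Z + s} ^+ 3
    = (-1) ^+ n * 2 ^+ n * 'L_{n%:Z + 3 * s} + (-1) ^ s * 3 * 'L_{2 * n%:Z + s}.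
Proof.
move: n s; apply: (@sum_binomial_rec _ _ (fun m => 'L_{m} ^+ 3)) => [s|n s].
  by rewrite ratL_cube mulr0 !add0r; ring.
set a := n%:Z + 3 * s; set b := 2 * n%:Z + s.
have -> : n.+1%:Z + 3 * s = a + 1 by rewrite /a; lia.
have -> : n%:Z + 3 * (s + 1) = a + 1 + 1 + 1 by rewrite /a; lia.
have -> : 2 * n.+1%:Z + s = b + 1 + 1 by rewrite /b; lia.
have -> : 2 * n%:Z + (s + 1) = b + 1 by rewrite /b; lia.
by rewrite signzS !ratL !ratFSS !exprS; ring.
Qed.

(** The exponents will be floor quotients; the equation as a hypothesis leaves their comparison to
    [lia]. *)
Lemma exp5S (a b : int) : b = a + 1 -> 5 ^ b = 5 * 5 ^ a :> rat.
Proof. by move=> ->; rewrite exprzDr // expr1z mulrC. Qed.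

Lemma sum_exp2_fib_cube (n : nat) (s : int) :
  \sum_(k < n.+1) 'C(n, k)%:R * 2 ^+ k * 'F_{k%:Z + s} ^+ 3
    = (if odd n then
         5 ^ ((n%:Z - 3) %/ 2)%Z
           * ('L_{3 * n%:Z + 3 * s} + (-1) ^ s * 3 * 'L_{s})
       else
         5 ^ ((n%:Z %/ 2)%Z - 1)
           * ('F_{3 * n%:Z + 3 * s} - (-1) ^ s * 3 * 'F_{s})).
Proof.
move: n s; apply: (@sum_binomial_rec _ _ (fun m => 'F_{m} ^+ 3)) => [s|n s].
  (* At n = 0 the power of 5 has exponent -1, the factor 1/5 of the cube formula. *)
  by rewrite ratF_cube mulr0 !add0r.
rewrite oddS; set a := 3 * n%:Z + 3 * s.
have -> : 3 * n.+1%:Z + 3 * s = a + 1 + 1 + 1 by rewrite /a; lia.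
have -> : 3 * n%:Z + 3 * (s + 1) = a + 1 + 1 + 1 by rewrite /a; lia.
(* Each step swaps F and L. From odd n, 5F_{a+3} = L_a + 2L_{a+3} yields a new factor 5; from even
   n, L_{a+3} = F_a + 2F_{a+3} keeps the power. *)
case odd_n: (odd n) => /=.
  rewrite (@exp5S ((n%:Z - 3) %/ 2)%Z); last by lia.
  by rewrite signzS !ratL !ratFSS; ring.
have -> : ((n.+1%:Z - 3) %/ 2)%Z = (n%:Z %/ 2)%Z - 1 by lia.
by rewrite signzS !ratL !ratFSS; ring.
Qed.

Lemma sum_exp2_lucas_cube (n : nat) (s : int) :
  \sum_(k < n.+1) 'C(n, k)%:R * 2 ^+ k * 'L_{k%:Z + s} ^+ 3
    = (if odd n then
         5 ^ ((n%:Z + 1) %/ 2)%Z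
           * ('F_{3 * n%:Z + 3 * s} - (-1) ^ s * 3 * 'F_{s})
       else
         5 ^ (n%:Z %/ 2)%Z
           * ('L_{3 * n%:Z + 3 * s} + (-1) ^ s * 3 * 'L_{s})).
Proof.
move: n s; apply: (@sum_binomial_rec _ _ (fun m => 'L_{m} ^+ 3)) => [s|n s].
  by rewrite /= ratL_cube mulr0 !add0r expr0z mul1r.
rewrite oddS; set a := 3 * n%:Z + 3 * s.
have -> : 3 * n.+1%:Z + 3 * s = a + 1 + 1 + 1 by rewrite /a; lia.
have -> : 3 * n%:Z + 3 * (s + 1) = a + 1 + 1 + 1 by rewrite /a; lia.
(* The same two relations with parities exchanged: now the factor 5 appears when n is even. *)
case odd_n: (odd n) => /=.
  have -> : (n.+1%:Z %/ 2)%Z = ((n%:Z + 1) %/ 2)%Z by lia.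
  by rewrite signzS !ratL !ratFSS; ring.
rewrite (@exp5S (n%:Z %/ 2)%Z); last by lia.
by rewrite signzS !ratL !ratFSS; ring.
Qed.

Theorem theorem2 (n : nat) (s : int) :
  [/\ (\sum_(k < n.+1) 'C(n, k)%:R * 'F_{k%:Z + s} ^+ 3
         = 5^-1 * (2 ^+ n * 'F_{2 * n%:Z + 3 * s} + 3 * 'F_{n%:Z - s}))
      /\
      (\sum_(k < n.+1) 'C(n, k)%:R * 'L_{k%:Z + s} ^+ 3
         = 2 ^+ n * 'L_{2 * n%:Z + 3 * s} + 3 * 'L_{n%:Z - s}),
      (\sum_(k < n.+1) (-1) ^+ k * 'C(n, k)%:R * 'F_{k%:Z + s} ^+ 3
         = 5^-1 * ((-1) ^+ n * 2 ^+ n * 'F_{n%:Z + 3 * s}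
                   - (-1) ^ s * 3 * 'F_{2 * n%:Z + s}))
      /\
      (\sum_(k < n.+1) (-1) ^+ k * 'C(n, k)%:R * 'L_{k%:Z + s} ^+ 3
         = (-1) ^+ n * 2 ^+ n * 'L_{n%:Z + 3 * s}
           + (-1) ^ s * 3 * 'L_{2 * n%:Z + s})
    & (\sum_(k < n.+1) 'C(n, k)%:R * 2 ^+ k * 'F_{k%:Z + s} ^+ 3
         = (if odd n then
              5 ^ ((n%:Z - 3) %/ 2)%Z
                * ('L_{3 * n%:Z + 3 * s} + (-1) ^ s * 3 * 'L_{s})
            else
              5 ^ ((n%:Z %/ 2)%Z - 1)
                * ('F_{3 * n%:Z + 3 * s} - (-1) ^ s * 3 * 'F_{s})))
      /\
      (\sum_(k < n.+1) 'C(n, k)%:R * 2 ^+ k * 'L_{k%:Z + s} ^+ 3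
         = (if odd n then
              5 ^ ((n%:Z + 1) %/ 2)%Z
                * ('F_{3 * n%:Z + 3 * s} - (-1) ^ s * 3 * 'F_{s})
            else
              5 ^ (n%:Z %/ 2)%Z
                * ('L_{3 * n%:Z + 3 * s} + (-1) ^ s * 3 * 'L_{s})))].
Proof.
split; split.
- rewrite -sum_fib_cube.
  by apply: eq_bigr => k _; rewrite expr1n mulr1.
- rewrite -sum_lucas_cube.
  by apply: eq_bigr => k _; rewrite expr1n mulr1.
- rewrite -alt_sum_fib_cube.
  by apply: eq_bigr => k _; rewrite ['C(n, k)%:R * _]mulrC.
- rewrite -alt_sum_lucas_cube.
  by apply: eq_bigr => k _; rewrite ['C(n, k)%:R * _]mulrC.
- exact: sum_exp2_fib_cube.
- exact: sum_exp2_lucas_cube.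
Qed.
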